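(* Let $N\ge 1$ and let $v_1,\dots,v_N\in\mathbb{C}$ be pairwise distinct. Let $V$ be the $N\times N$ Vandermonde matrix with entries $V_{k,l}=v_l^{\,k-1}$, $1\le k,l\le N$. Then for every row index $1\le i\le N$ and column index $1\le j\le N$, the $(i,j)$ entry of the inverse of $V$ is $$\left(V^{-1}\right)_{i,j}=\begin{cases}\dfrac{(-1)^{N-j}}{\lambda_i}\,\sigma^{(i)}_{N-1,N-j}, & 1\le j\le N-1,\\[2mm] \dfrac{1}{\lambda_i}, & j=N,\end{cases}$$ where $$\lambda_i=\prod_{\substack{k=1\\ k\neq i}}^{N}(v_i-v_k),$$ and $\sigma^{(i)}_{N-1,N-j}$ is the $(N-j)$-th elementary symmetric polynomial of the $N-1$ nodes $v_1,\dots,v_{i-1},v_{i+1},\dots,v_N$. Here, for $1\le j\le N-1$ and with $n=N-j$, $\sigma^{(i)}_{N-1,n}$ is obtained as $\sigma^{(i)}_{N-1,n}=\frac{1}{n!}C_{n-1}$ from the recursion over $d\in\{1,\dots,N\}\setminus\{i\}$ given by $f_0(v_d)=v_d$, $C_0=\sum_{d\ne i}f_0(v_d)$, and $$f_m(v_d)=v_d\left[C_{m-1}-(n-m)f_{m-1}(v_d)\right],\qquad C_m=\sum_{d\neq i}f_m(v_d),\qquad m=1,\dots,n-1.$$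
   Context: The elementary symmetric polynomial with the $i$-th node removed is, for $1\le n\le N-1$, $$\sigma^{(i)}_{N-1,n}=\sum_{\{r_1,\dots,r_n\}\subseteq\{1,\dots,N\}\setminus\{i\}} v_{r_1}v_{r_2}\cdots v_{r_n},$$ where the sum runs over all $n$-element subsets of $\{1,\dots,N\}\setminus\{i\}$ (each set of indices counted once). An empty product equals $1$. Explicitly, the Vandermonde matrix is $$V=\begin{bmatrix}1&1&\cdots&1\\ v_1&v_2&\cdots&v_N\\ \vdots&\vdots&&\vdots\\ v_1^{N-1}&v_2^{N-1}&\cdots&v_N^{N-1}\end{bmatrix}.$$ *)

(* Defs.v *)
From HB Require Import structures.
From mathcomp Require Import all_boot all_order all_algebra.
From mathcomp Require Import reals.
From mathcomp Require Import complex.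

Set Implicit Arguments.
Unset Strict Implicit.
Unset Printing Implicit Defensive.

Import GRing.Theory.
Local Open Scope ring_scope.

Section NodeRemoved.

Variables (F : fieldType) (N : nat) (v : 'I_N -> F).

(* sigma^{(i)}_{N-1,n} *)
Definition esym_removed (i : 'I_N) (n : nat) : F :=
  \sum_(A : {set 'I_N} | (A \subset [set~ i]) && (#|A| == n))
    \prod_(r in A) v r.

Definition node_lambda (i : 'I_N) : F := \prod_(k < N | k != i) (v i - v k).

(* [rec_f i n m d] is f_m(v_d), for fixed i and n. The value at d = i is never
   used: every sum below is restricted to d != i. The factor n - m is the
   difference in F, so it is not truncated; only m < n is meaningful. *)
Fixpoint rec_f (i : 'I_N) (n m : nat) (d : 'I_N) : F :=
  if m is m'.+1 then
    v d * (\sum_(e < N | e != i) rec_f i n m' e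
           - (n%:R - m%:R) * rec_f i n m' d)
  else v d.

(* C_m *)
Definition rec_C (i : 'I_N) (n m : nat) : F :=
  \sum_(d < N | d != i) rec_f i n m d.

End NodeRemoved.

(* Main.v *)
Require Import Defs.
From mathcomp Require Import all_boot all_order all_algebra.
From mathcomp Require Import reals.
From mathcomp Require Import complex.
From mathcomp Require Import ring.

(** There are two independent arguments.

    Inverse matrix. Let [L_i] be the product of ['X - v_k] over [k != i]. Its
    value at [v_l] is [0] for [l != i] and [lambda_i] for [l = i], and
    [lambda_i] is nonzero because the nodes are distinct, so the matrix whose
    row [i] lists the coefficients of [L_i / lambda_i] is a left inverse of the
    Vandermonde matrix ([mul_node_poly_Vandermonde]). By Viete's formula
    ([coef_prod_XsubC_set]) the coefficients of [L_i] are the signed elementary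
    symmetric polynomials of the nodes other than [v_i].

    Recursion. Write [e_r(A)] for the elementary symmetric polynomials of the
    nodes in the set [A] of all nodes but [v_i]. For [0 < m < n - 1] the sum
    [C_m] depends on [n] and is not in general a multiple of [e_(m+1)(A)], so
    [C_(n-1) = n! e_n(A)] has no direct induction on [m]. The quantity that does
    satisfy one is the weighted sum
      [S_m(r) = \sum_(d in A) f_m(v_d) e_r(A \ d)].
    Substituting the recursion for [f_m] and replacing [v_d e_r(A \ d)] by
    [e_(r+1)(A) - e_(r+1)(A \ d)] gives
      [S_m(r) = (r + 1 - (n - m)) C_(m-1) e_(r+1)(A) + (n - m) S_(m-1)(r+1)],
    where the first term uses [\sum_d v_d e_r(A \ d) = (r+1) e_(r+1)(A)]
    ([sum_mul_elem_sym_setD1]) and vanishes on the line [r = n - m - 1].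
    Following this line from [S_(n-1)(0) = C_(n-1)] to [S_0(n-1) = n e_n(A)]
    collects the factor [(n-1)!]. *)

Import GRing.Theory.
Local Open Scope ring_scope.
Local Open Scope complex_scope.

(** * Elementary symmetric polynomials over a finite set *)

Section ElemSym.

Set Implicit Arguments.
Unset Strict Implicit.

Variables (R : comNzRingType) (T : finType) (v : T -> R).

Definition elem_sym (A : {set T}) (n : nat) : R :=
  \sum_(B : {set T} | (B \subset A) && (#|B| == n)) \prod_(r in B) v r.

Lemma elem_sym0 A : elem_sym A 0 = 1.
Proof.
rewrite /elem_sym (big_pred1 set0) ?big_set0 // => B /=.
by rewrite cards_eq0; case: eqP => [->|]; rewrite ?sub0set ?andbF.
Qed.

(** Removing [d] is a bijection from the [n.+1]-subsets of [A] containing [d] to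
    the [n]-subsets of [A :\ d]. *)
Lemma mul_elem_sym_setD1 (A : {set T}) d n : d \in A ->
  v d * elem_sym (A :\ d) n =
  \sum_(B : {set T} | (B \subset A) && (#|B| == n.+1) && (d \in B))
    \prod_(r in B) v r.
Proof.
move=> dA.
rewrite (reindex_onto (fun B => d |: B) (fun B => B :\ d)) /=; last first.
  by move=> B /andP[_ dB]; rewrite setD1K.
rewrite /elem_sym mulr_sumr; apply: eq_big => [B|B /andP[]].
  rewrite subsetD1 subUset sub1set dA setU11 andbT /=.
  have [dB|dB] := boolP (d \in B); last first.
    by rewrite setU1K // eqxx cardsU1 dB add1n eqSS !andbT.
  have /negPf -> : (d |: B) :\ d != B; last by rewrite !andbF.
  by apply: contraTneq dB => <-; rewrite !inE eqxx.
rewrite subsetD1 => /andP[_ dB] _.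
by rewrite big_setU1.
Qed.

Lemma elem_sym_setD1 (A : {set T}) d n : d \in A ->
  elem_sym A n.+1 = elem_sym (A :\ d) n.+1 + v d * elem_sym (A :\ d) n.
Proof.
move=> dA; rewrite mul_elem_sym_setD1 // {1}/elem_sym (bigID (fun B : {set T} => d \in B)) /= addrC.
congr (_ + _); apply: eq_bigl => B.
by rewrite subsetD1 -!andbA [(d \notin B) && _]andbC.
Qed.

(** Each [n.+1]-subset of [A] arises once for each of its elements [d]. *)
Lemma sum_mul_elem_sym_setD1 (A : {set T}) n :
  \sum_(d in A) v d * elem_sym (A :\ d) n = n.+1%:R * elem_sym A n.+1.
Proof.
under eq_bigr => d dA do rewrite mul_elem_sym_setD1 //.
rewrite (exchange_big_dep (fun B : {set T} => (B \subset A) && (#|B| == n.+1))) /=; last first.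
  by move=> d B _ /andP[].
rewrite /elem_sym mulr_sumr; apply: eq_bigr => B /[dup] sBA /andP[/subsetP sB /eqP cB].
rewrite (eq_bigl (mem B)) => [|d]; last first.
  by rewrite /= sBA /=; case: (boolP (d \in B)) => [/sB ->|]; rewrite ?andbF.
by rewrite sumr_const cB mulr_natl.
Qed.

(** Viete's formula for roots indexed by a finite set, obtained by expanding the
    product of the [-v k + 'X]. *)
Lemma coef_prod_XsubC_set (A : {set T}) (j : nat) : (j <= #|A|)%N ->
  (\prod_(k in A) ('X - (v k)%:P))`_j = (-1) ^+ (#|A| - j) * elem_sym A (#|A| - j).
Proof.
move=> jA.
(* Factors outside A are written 0 + 1, so that subsets B not contained in A
   contribute nothing to the expansion over all subsets. *)
rewrite big_mkcond /= (eq_bigr (fun k =>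
  (if k \in A then - (v k)%:P else 0) + (if k \in A then 'X else 1))); last first.
  by move=> k _; case: ifP => _; rewrite ?add0r // addrC.
rewrite bigA_distr /= coef_sum /elem_sym mulr_sumr [RHS]big_mkcond /=.
apply: eq_bigr => B _.
have [sBA|/subsetPn[k kB kA]] /= := boolP (B \subset A); last first.
  by rewrite (bigD1 k) //= kB (negPf kA) mul0r coef0.
have -> : \prod_i (if i \in B then if i \in A then - (v i)%:P else 0
                   else if i \in A then 'X else 1)
        = ((-1) ^+ #|B| * \prod_(i in B) v i)%:P * 'X^(#|A| - #|B|).
  rewrite (bigID (mem B)) /=; congr (_ * _).
    rewrite -prodrN rmorph_prod; apply: eq_bigr => i iB.
    by rewrite iB (subsetP sBA _ iB) rmorphN.
  have -> : (#|A| - #|B| = #|A :\: B|)%N by rewrite cardsD (setIidPr sBA).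
  rewrite -prodr_const.
  rewrite (eq_bigr (fun k => if k \in A then 'X else 1)) => [|k /negPf /= -> //].
  by rewrite -big_mkcondr; apply: eq_bigl => k; rewrite !inE.
rewrite coefCM coefXn.
have cBA := subset_leq_card sBA.
have -> : (j == #|A| - #|B|)%N = (#|B| == #|A| - j)%N.
  by rewrite -(eqn_add2r #|B|) subnK // -[RHS](eqn_add2r j) subnK // addnC.
by case: eqP => [->|_]; rewrite ?mulr1 ?mulr0.
Qed.

End ElemSym.

(** * The recursion for the elementary symmetric polynomials *)

Section Recursion.

Set Implicit Arguments.
Unset Strict Implicit.

Variables (F : fieldType) (N : nat) (v : 'I_N -> F) (i : 'I_N).

Let A : {set 'I_N} := [set~ i].

Lemma rec_CE n m : rec_C v i n m = \sum_(d in A) rec_f v i n m d.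
Proof. by apply: eq_bigl => d; rewrite !inE. Qed.

(** The sum [S_m(r)]: the weight of [f_m(v_d)] is an elementary symmetric
    polynomial of the nodes other than [v_i] and [v_d]. *)
Definition rec_S (n m r : nat) : F :=
  \sum_(d in A) rec_f v i n m d * elem_sym v (A :\ d) r.

(** Along [m + r = n - 1] the terms carrying [C_m] cancel: their total weight is
    the number [r.+1] of times each product is counted, minus [n - m.+1 = r.+1]. *)
Lemma rec_S_step m r :
  rec_S (m.+1 + r).+1 m.+1 r = r.+1%:R * rec_S (m.+1 + r).+1 m r.+1.
Proof.
set n := (m.+1 + r).+1.
have nm : n%:R - m.+1%:R = r.+1%:R :> F.
  by rewrite /n -addnS natrD addrC addKr.
transitivity (\sum_(d in A) (rec_C v i n m * (v d * elem_sym v (A :\ d) r)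
   - r.+1%:R * (rec_f v i n m d * elem_sym v A r.+1)
   + r.+1%:R * (rec_f v i n m d * elem_sym v (A :\ d) r.+1))).
  apply: eq_bigr => d dA; rewrite (elem_sym_setD1 _ _ dA) /= nm -/(rec_C v i n m).
  ring.
rewrite big_split /= sumrB -!mulr_sumr -mulr_suml sum_mul_elem_sym_setD1 -rec_CE.
by rewrite mulrCA subrr add0r.
Qed.

Lemma rec_S_fact m r :
  rec_S (m + r).+1 m r * r`!%:R = (m + r)`!%:R * rec_S (m + r).+1 0 (m + r).
Proof.
elim: m r => [|m IHm] r; first by rewrite mulrC.
rewrite rec_S_step mulrAC -natrM -factS mulrC.
by rewrite addSnnS IHm.
Qed.

Lemma rec_C_esym_removed n : rec_C v i n.+1 n = n.+1`!%:R * esym_removed v i n.+1.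
Proof.
have := rec_S_fact n 0; rewrite addn0 fact0 mulr1 {1}/rec_S.
under eq_bigr => d _ do rewrite elem_sym0 mulr1.
by rewrite -rec_CE => ->; rewrite /rec_S sum_mul_elem_sym_setD1 mulrA -natrM mulnC.
Qed.

End Recursion.

(** * Lagrange polynomials and the inverse matrix *)

Section Lagrange.

Set Implicit Arguments.
Unset Strict Implicit.

Variables (F : fieldType) (N : nat) (v : 'I_N -> F).

Definition node_poly (i : 'I_N) : {poly F} :=
  \prod_(k in [set~ i]) ('X - (v k)%:P).

Lemma size_node_poly i : size (node_poly i) = N.
Proof.
rewrite /node_poly -big_enum size_prod_XsubC -cardE cardsC1 card_ord.
by rewrite prednK // (leq_ltn_trans _ (ltn_ord i)).
Qed.

Lemma coef_node_poly (i j : 'I_N) :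
  (node_poly i)`_j = (-1) ^+ (N - j.+1) * esym_removed v i (N - j.+1).
Proof.
have N1j : (N.-1 - j = N - j.+1)%N by rewrite subnS -subn1 subnAC subn1.
rewrite coef_prod_XsubC_set cardsC1 card_ord ?N1j //.
by rewrite -ltnS prednK // (leq_ltn_trans _ (ltn_ord i)).
Qed.

Lemma horner_node_poly (i l : 'I_N) :
  (node_poly i).[v l] = if l == i then node_lambda v i else 0.
Proof.
rewrite /node_poly horner_prod; case: eqP => [->|/eqP li].
  by apply: eq_big => [k|k _]; rewrite ?inE // hornerXsubC.
by rewrite (bigD1 l) ?inE //= hornerXsubC subrr mul0r.
Qed.

Lemma node_lambda_neq0 i : injective v -> node_lambda v i != 0.
Proof.
by move=> hv; apply/prodf_neq0 => k ki; rewrite subr_eq0 (inj_eq hv) eq_sym.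
Qed.

Lemma mul_node_poly_Vandermonde : injective v ->
  (\matrix_(i, j) ((node_poly i)`_j / node_lambda v i))
    *m Vandermonde N (\row_l v l) = 1%:M.
Proof.
move=> hv; apply/matrixP => i l; rewrite !mxE.
transitivity ((node_poly i).[v l] / node_lambda v i).
  rewrite (@horner_coef_wide _ N) ?size_node_poly // mulr_suml.
  by apply: eq_bigr => j _; rewrite !mxE mulrAC.
rewrite horner_node_poly eq_sym; case: eqP => _; last by rewrite mul0r.
by rewrite divff // node_lambda_neq0.
Qed.

End Lagrange.

(* Indices are 0-based: the paper's column j is j.+1 here, so its N - j is
   (N - j.+1)%N and its j <= N - 1 is (j.+1 < N)%N. *)
Theorem theorem2p2 (R : realType) (N : nat) (v : 'I_N -> R[i])
  (hN : (1 <= N)%N) (hv : injective v) :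
  let V : 'M[R[i]]_N := Vandermonde N (\row_(l < N) v l) in
  V \in unitmx /\
  (forall i j : 'I_N,
     invmx V i j =
       if (j.+1 < N)%N
       then (-1) ^+ (N - j.+1)%N / node_lambda v i
            * esym_removed v i (N - j.+1)%N
       else 1 / node_lambda v i) /\
  (forall i j : 'I_N, (j.+1 < N)%N ->
     let n := (N - j.+1)%N in
     esym_removed v i n = 1 / (n`!)%:R * rec_C v i n n.-1).
Proof.
move=> V; have WV := mul_node_poly_Vandermonde hv.
have [_ uV] := mulmx1_unit WV; split=> //; split=> i j.
  rewrite -[invmx V]mul1mx -WV mulmxK // mxE coef_node_poly.
  case: ltnP => [_|Nj]; first by rewrite mulrAC.
  have -> : (N - j.+1 = 0)%N by apply/eqP; rewrite subn_eq0.
  by rewrite expr0 /esym_removed -/(elem_sym v [set~ i] 0) elem_sym0 mulr1.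
rewrite -subn_gt0 => n0 /=; move: n0; case: (N - j.+1)%N => // n _.
rewrite rec_C_esym_removed mulrA div1r mulVf ?mul1r //.
by rewrite Num.Theory.pnatr_eq0 -lt0n fact_gt0.
Qed.
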